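(* Let $G$ be an abelian group, let $X$ be a compact Hausdorff space, and let $\theta$ be a partial action of $G$ on the topological space $X$ such that $X_g$ is clopen for each $g\in G$. Let $B$ be a simple associative topological real algebra which has a set $E$ of local units and which satisfies property (P) given in the context. Let $C_E(X,B)\star_\alpha G$ be the partial skew group ring of the partial action $\alpha$ of $G$ on $C_E(X,B)$ induced by $\theta$. Then the following three assertions are equivalent: (i) $C_E(X,B)\star_\alpha G$ is simple; (ii) $\theta$ is topologically minimal and topologically free; (iii) $\theta$ is topologically minimal and faithful.
   Context: Rings are associative but not necessarily unital; ideals are two-sided. A set $E$ of idempotents of a ring $R$ is a set of local units for $R$ if for every finite subset $F$ of $R$ there is $f\in E$ with $F\subseteq fRf$. Partial action on a topological space: a partial action $\theta$ of a group $G$ (identity $e$) on a topological space $X$ is a family of open subsets $\{X_g\}_{g\in G}$ of $X$ and homeomorphisms $\theta_g : X_{g^{-1}}\to X_g$ such that for all $g,h\in G$: (i) $X_e=X$ and $\theta_e=\mathrm{id}_X$; (ii) $\theta_g(X_{g^{-1}}\cap X_h)=X_g\cap X_{gh}$; (iii) $\theta_g(\theta_h(x))=\theta_{gh}(x)$ for all $x\in X_{h^{-1}}\cap X_{(gh)^{-1}}$. A partial action on a ring is defined in the same way, requiring the subsets to be ideals and the bijections to be ring isomorphisms. A subset $Y\subseteq X$ is $G$-invariant if $\theta_g(Y\cap X_{g^{-1}})\subseteq Y$ for all $g\in G$. $\theta$ is topologically minimal if $X$ and $\emptyset$ are the only $G$-invariant closed subsets of $X$. $\theta$ is faithful if for each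 $g\in G\setminus\{e\}$ there is some $x\in X_{g^{-1}}$ with $\theta_g(x)\ne x$. $\theta$ is topologically free if for each $g\in G\setminus\{e\}$ the set of $x\in X_{g^{-1}}$ with $\theta_g(x)=x$ has empty interior. $C_E(X,B)=\bigcup_{\epsilon\in E}C(X,\epsilon B\epsilon)$, where $C(X,\epsilon B\epsilon)$ is the set of continuous functions $X\to\epsilon B\epsilon$; it is a ring under pointwise operations. For $b\in B$, $b_X$ denotes the constant function $X\to B$ with value $b$. Property (P): there is a continuous map $q : B\to\mathbb{R}_{\ge 0}$ satisfying $q(b)>0$ for all non-zero $b\in B$, and $(q\circ f)\,\epsilon_X\in I$ for every ideal $I$ of $C_E(X,B)$, every $\epsilon\in E$ and every $f\in I\cap C(X,\epsilon B\epsilon)$. For $g\in G$, $D_g$ is the ideal of all $f\in C_E(X,B)$ with $f(x)=0$ for all $x\in X\setminus X_g$, and $\alpha_g : D_{g^{-1}}\to D_g$ is given by $\alpha_g(f)=f\circ\theta_{g^{-1}}$ on $X_g$ and $0$ on $X\setminus X_g$. When each $X_g$ is clopen this is a partial action $\alpha$ of $G$ on $C_E(X,B)$. Partial skew group ring: for a partial action $\alpha$ of $G$ on a ring $A$ with ideals $D_g$, $A\star_\alpha G$ is the set of finite formal sums $\sum_{g\in G} a_g\delta_g$ with $a_g\in D_g$, with the obvious addition and with multiplication extending biadditively $(a_g\delta_g)(b_h\delta_h)=\alpha_g(\alpha_{g^{-1}}(a_g)b_h)\delta_{gh}$ for $a_g\in D_g$, $b_h\in D_h$.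
   Formalization: The implication from (ii) to (iii) is proved only when every X_g is nonempty (it fails if X is a point, G = Z/2 and X_g is empty for g ≠ e), and X is assumed nonempty; (i)⇔(ii) and (iii)⇒(ii) need no condition on the X_g. *)

(* Defs.v *)
From HB Require Import structures.
From mathcomp Require Import all_boot all_order all_algebra.
From mathcomp Require Import all_classical all_reals all_analysis.
Set Implicit Arguments.
Unset Strict Implicit.
Unset Printing Implicit Defensive.
Import Order.TTheory GRing.Theory Num.Theory.
Import numFieldNormedType.Exports.
Local Open Scope classical_set_scope.
Local Open Scope ring_scope.

(* Rings need not be unital here, so the ring structures of ssralg do not
   apply.  A ring is given as a set A of elements of a zmodType V, together
   with a product mul on V; A = setT when V itself is the ring. *)
Section NonUnitalRings.
Variables (V : zmodType) (mul : V -> V -> V).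

Definition is_ideal (A I : set V) : Prop :=
  [/\ I `<=` A,
      I 0,
      forall a b, I a -> I b -> I (a - b) &
      forall a b, A a -> I b -> I (mul a b) /\ I (mul b a)].

Definition is_simple (A : set V) : Prop :=
  (exists2 a, A a & a != 0) /\
  forall I, is_ideal A I -> I = [set 0] \/ I = A.

Definition corner (e : V) : set V := [set mul (mul e b) e | b in setT].

Definition local_units (E : set V) : Prop :=
  (forall e, E e -> mul e e = e) /\
  forall F : set V, finite_set F -> exists2 f, E f & F `<=` corner f.

End NonUnitalRings.

HB.mixin Record TopologicalLmodule_isTopologicalAlgebra (R : numDomainType) B
    & TopologicalLmodule R B := {
  amul : B -> B -> B ;
  amulA : associative amul ;
  amulDl : left_distributive amul +%R ;
  amulDr : right_distributive amul +%R ;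
  amulZl : forall (r : R) (a b : B), amul (r *: a) b = r *: amul a b ;
  amulZr : forall (r : R) (a b : B), amul a (r *: b) = r *: amul a b ;
  amul_continuous : continuous (fun z : B * B => amul z.1 z.2) ;
}.

(* Topological associative algebras, not necessarily unital. *)
#[short(type="topologicalAlgType")]
HB.structure Definition TopologicalAlgebra (R : numDomainType) :=
  {B of TopologicalLmodule R B & TopologicalLmodule_isTopologicalAlgebra R B}.

Definition homeomorphism_on (X Y : topologicalType) (A : set X) (B : set Y)
    (f : X -> Y) : Prop :=
  [/\ set_bij A B f,
      {within A, continuous f} &
      exists2 f' : Y -> X,
        (forall x, A x -> f' (f x) = x) & {within B, continuous f'}].

(* theta_g is represented by a total function pact g; its values outside
   X_(g^-1) = pdom g^-1 are irrelevant. *)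
Record partial_action (G : groupType) (X : topologicalType) := PartialAction {
  pdom : G -> set X ;
  pact : G -> X -> X ;
  pdom_open : forall g, open (pdom g) ;
  pact_homeo : forall g, homeomorphism_on (pdom g^-1%g) (pdom g) (pact g) ;
  pdom1 : pdom 1%g = setT ;
  pact1 : forall x, pact 1%g x = x ;
  pact_dom : forall g h,
    pact g @` (pdom g^-1%g `&` pdom h) = pdom g `&` pdom (g * h)%g ;
  pactM : forall g h x, pdom h^-1%g x -> pdom (g * h)^-1%g x ->
    pact g (pact h x) = pact (g * h)%g x
}.

Section PartialActions.
Variables (G : groupType) (X : topologicalType) (theta : partial_action G X).

Definition invariant_set (Y : set X) : Prop :=
  forall g, pact theta g @` (Y `&` pdom theta g^-1%g) `<=` Y.

Definition topologically_minimal : Prop :=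
  forall C : set X, closed C -> invariant_set C -> C = set0 \/ C = setT.

Definition faithful_action : Prop :=
  forall g : G, g <> 1%g ->
    exists2 x, pdom theta g^-1%g x & pact theta g x <> x.

Definition topologically_free : Prop :=
  forall g : G, g <> 1%g ->
    interior [set x | pdom theta g^-1%g x /\ pact theta g x = x] = set0.

End PartialActions.

Section ContinuousFunctions.
Variables (R : realType) (X : topologicalType) (B : topologicalAlgType R).
Implicit Types (E : set B) (f g : X -> B).

(* A map into eBe is continuous for the subspace topology of eBe iff it is
   continuous as a map into B. *)
Definition C_corner (e : B) : set (X -> B) :=
  [set f | continuous f /\ forall x, corner (@amul R B) e (f x)].

Definition C_E E : set (X -> B) := \bigcup_(e in E) C_corner e.

Definition fmul f g : X -> B := fun x => amul (f x) (g x).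

Definition property_P E : Prop :=
  exists q : B -> R,
    [/\ continuous q,
        forall b, 0 <= q b,
        forall b, b != 0 -> 0 < q b &
        forall I : set (X -> B), is_ideal fmul (C_E E) I ->
        forall e f, E e -> I f -> C_corner e f ->
          I (fun x => q (f x) *: e)].

Variables (G : groupType) (theta : partial_action G X).

Definition D_ideal E (g : G) : set (X -> B) :=
  [set f | C_E E f /\ forall x, ~ pdom theta g x -> f x = 0].

Definition alpha (g : G) f : X -> B :=
  patch (fun=> 0) (pdom theta g) (f \o pact theta g^-1%g).

End ContinuousFunctions.

(* The sum of the a_g delta_g is represented by the function g |-> a_g; in a
   product, the coefficient at k collects the pairs (g, h) with h = g^-1 k. *)
Section PartialSkewGroupRing.
Variables (G : groupType) (V : zmodType) (mul : V -> V -> V).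
Variables (D : G -> set V) (al : G -> V -> V).

Definition skew_ring : set (G -> V) :=
  [set a | (forall g, D g (a g)) /\ finite_set [set g | a g != 0]].

Definition skew_mul (a b : G -> V) : G -> V := fun k =>
  \sum_(g \in [set g | a g != 0])
    al g (mul (al g^-1%g (a g)) (b (g^-1 * k)%g)).

Definition simple_skew_ring : Prop := is_simple skew_mul skew_ring.

End PartialSkewGroupRing.

(* Main.v *)
Require Import Defs.
From mathcomp Require Import all_boot all_order all_algebra.
From mathcomp Require Import all_classical all_reals all_analysis.

(** Everything rests on one formula for the product of the partial skew group
ring, [(a b)_k (x) = sum_g a_g(x) b_(g^-1 k)(theta_(g^-1) x)], which holds at
every point because [a_g] vanishes off [X_g].  It turns each algebraic claim
into a pointwise one ([skew_mulE], [single_mulE], [mul_singleE]).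

Simplicity implies minimality.  The elements all of whose coefficients vanish
on a closed invariant set [C] form an ideal ([vanishing_ideal_ideal]).  By
Urysohn's lemma it is zero only when [C = X], and it is everything only when
[C] is empty.

For the second half, let [F_g] be the fixed-point set of [theta_g].  It is
closed since [X] is Hausdorff and the domains are clopen, and it is invariant
since [G] is abelian; so if theta is minimal, [F_g] is empty or [X]
([fixed_set_dichotomy]).  Hence a failure of topological freeness at some
[g <> 1] means that [theta_g] is the identity of [X].  This contradicts
faithfulness outright.  It also contradicts simplicity: the shift
[(tau a)_k = a_(g^-1 k)] then commutes with left and right multiplications, so
the elements [a - tau a] form an ideal.  That ideal is not zero, and it is
proper because the augmentation [a |-> sum_k a_k(x)] kills it.

Minimality and freeness imply simplicity.  Let [J] be a nonzero ideal and [I]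
the ideal of the [f] with [f delta_1] in [J].  Some [a] in [J] has [a_1 <> 0], since
multiplication by [e delta_(g^-1)] moves coefficients ([ideal_diag_coef]).
By freeness the open set where [a_1 <> 0] has a point moved by all the other
[g] in the support of [a]; a bump function [p] concentrated near that point
satisfies [p(y) p(theta_(g^-1) y) = 0] for those [g] and all [y], so that
[(p e) a (p e) = p^2 a_1 delta_1] and [I] is nonzero
([ideal_meets_base]).  For a local unit [e], the scalar functions [p >= 0]
with [p e] in [I] have a closed invariant common zero set, which is not [X] by
property (P), hence is empty.  A finite sum of such functions is then positive
on the compact space [X] and can be inverted, so the constant [e] lies in [I]
([ideal_contains_units]); these constants generate the whole ring. *)

Set Implicit Arguments.
Unset Strict Implicit.
Unset Printing Implicit Defensive.
Import Order.TTheory GRing.Theory Num.Theory.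
Import numFieldNormedType.Exports.
Local Open Scope classical_set_scope.
Local Open Scope ring_scope.
Local Notation "a ** b" := (amul a b) (at level 40, left associativity).

(** * Non-unital algebra and corners *)

Section AlgebraArithmetic.
Context {R : realType} {B : topologicalAlgType R}.
Implicit Types (a b c e : B).

Lemma amul0l b : 0 ** b = 0.
Proof. by apply: (@addrI B (0 ** b)); rewrite -amulDl !addr0. Qed.

Lemma amul0r b : b ** 0 = 0.
Proof. by apply: (@addrI B (b ** 0)); rewrite -amulDr !addr0. Qed.

Lemma amulNl a b : - a ** b = - (a ** b).
Proof. by apply: (@addrI B (a ** b)); rewrite -amulDl !subrr amul0l. Qed.

Lemma amulNr a b : a ** - b = - (a ** b).
Proof. by apply: (@addrI B (a ** b)); rewrite -amulDr !subrr amul0r. Qed.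

Lemma amulBl a b c : (a - b) ** c = a ** c - b ** c.
Proof. by rewrite amulDl amulNl. Qed.

Lemma amulBr a b c : a ** (b - c) = a ** b - a ** c.
Proof. by rewrite amulDr amulNr. Qed.

Lemma cornerP e b : e ** e = e ->
  corner (@amul R B) e b <-> e ** b = b /\ b ** e = b.
Proof.
move=> ee; split=> [[c _ <-]|[eb be]]; last by exists b; rewrite // eb be.
by rewrite -!amulA ee !amulA ee.
Qed.

(** A zero unit would have a zero corner, which contains no nonzero element. *)
Lemma local_unit_neq0 (E : set B) : local_units (@amul R B) E ->
  (exists b : B, b != 0) -> exists2 e, E e & e != 0.
Proof.
move=> [_ EF] [b b0]; have [e Ee be] := EF [set b] (finite_set1 b).
exists e => //; apply: contraNneq b0 => e0.
by have [//|c _ <-] := be b; rewrite e0 amul0r.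
Qed.

End AlgebraArithmetic.

(** * Continuous functions and separation *)

Section Continuity.
Context {R : realType} {X : topologicalType} {B : topologicalAlgType R}.
Implicit Types (f g : X -> B) (p : X -> R).

Lemma continuous_sub f g : continuous f -> continuous g ->
  continuous (fun x => f x - g x).
Proof.
move=> cf cg x; exact: (@continuous2_cvg X B B B _ (nbhs_filter x) f g
  (fun a b => a - b) _ _ (@sub_continuous B (f x, g x)) (cf x) (cg x)).
Qed.

Lemma continuous_amul f g : continuous f -> continuous g ->
  continuous (fun x => f x ** g x).
Proof.
move=> cf cg x; exact: (@continuous2_cvg X B B B _ (nbhs_filter x) f g
  (@amul R B) _ _ (@amul_continuous R B (f x, g x)) (cf x) (cg x)).
Qed.

Lemma continuous_scale p f : continuous p -> continuous f ->
  continuous (fun x => p x *: f x).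
Proof.
move=> cf cg x; exact: (@continuous2_cvg X R^o B B _ (nbhs_filter x) p f
  (fun (r : R^o) (b : B) => r *: b) _ _
  (@scale_continuous R B (p x, f x)) (cf x) (cg x)).
Qed.

(** Both a clopen set and its complement are neighbourhoods of their points, so
the two pieces do not interact. *)
Lemma continuous_patch0 (Y : topologicalType) (A : set X) (f : X -> Y) (y : Y) :
  clopen A ->
  {within A, continuous f} -> continuous (patch (fun=> y) A f).
Proof.
move=> [oA cA] /subspace_continuousP cf x.
have [Ax|nAx] := pselect (A x).
  have nA : nbhs x A by exact: open_nbhs_nbhs.
  have := cf x Ax; rewrite (within_interior nA) => fx U.
  rewrite patchT ?inE// => /fx fU; apply: (filterS2 _ _ nA fU) => z Az Uz.
  by rewrite /= patchT ?inE.
have nA : nbhs x (~` A).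
  by apply: open_nbhs_nbhs; split=> //; exact: closed_openC.
move=> U; rewrite patchC ?inE// => /nbhs_singleton Uy.
by apply: filterS nA => z nAz; rewrite /= patchC ?inE.
Qed.

End Continuity.

Section Topology.
Context {X : topologicalType}.

Lemma urysohn_bump (R : realType) (x : X) (V : set X) :
  hausdorff_space X -> compact [set: X] -> nbhs x V ->
  exists p : X -> R, [/\ continuous p, p x = 1 & forall y, ~ V y -> p y = 0].
Proof.
move=> hX cX nV; pose C := ~` interior V.
have cC : closed C by apply: open_closedC; exact: open_interior.
have cx : closed [set x].
  by apply: accessible_closed_set1; exact: hausdorff_accessible.
have Cx0 : C `&` [set x] = set0.
  by apply/seteqP; split=> // y [/= nVy yx]; apply: nVy; rewrite yx.
have /(@normal_separatorP R X)/(_ C [set x] cC cx Cx0) := compact_normal hX cX.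
move=> /(@uniform_separatorP _ R)[p [cp _ p0 p1]].
exists p; split=> //; first by apply: (p1 (p x)); exists x.
by move=> y nVy; apply: (p0 (p y)); exists y => // /interior_subset.
Qed.

(** The finite case of Baire's theorem, valid in every topological space: one
closed set with empty interior is removed from [U] at a time. *)
Lemma avoid_nowhere_dense (I : eqType) (s : seq I) (F : I -> set X)
    (U : set X) :
    (forall i, i \in s -> closed (F i) /\ interior (F i) = set0) ->
    open U -> U !=set0 ->
  exists2 x, U x & forall i, i \in s -> ~ F i x.
Proof.
elim: s U => [|i s IHs] U Fs oU [x Ux]; first by exists x.
have [|cF iF] := Fs i; first exact: mem_head.
have [j js|||y [Uy nFy] ys] := IHs (U `&` ~` F i).
- by apply: Fs; rewrite inE js orbT.
- by apply: openI => //; exact: closed_openC.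
- apply: contrapT => /set0P/negP/negPn/eqP UF.
  suff : interior (F i) x by rewrite iF.
  apply: (@filterS _ _ _ U); last exact: open_nbhs_nbhs.
  by move=> z Uz; apply: contrapT => nFz; have : set0 z by rewrite -UF.
exists y => // j; rewrite inE => /orP[/eqP->//|]; exact: ys.
Qed.

(** Compactness is applied to the sets [p > 0], which cover [X].  Since [P] is
closed under sums it is directed upwards, and near coverings along this
direction replace the choice of a finite subcover. *)
Lemma common_positive (R : realType) (P : set (X -> R)) : compact [set: X] ->
    P (fun=> 0) -> (forall p, P p -> continuous p /\ forall x, 0 <= p x) ->
    (forall p r, P p -> P r -> P (fun x => p x + r x)) ->
    (forall x, exists2 p, P p & 0 < p x) ->
  exists2 p, P p & forall x, 0 < p x.
Proof.
move=> /compact_near_coveringP cX P0 Pc PD Pgt0.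
pose above p := [set r | P r /\ forall x, p x <= r x].
have FF : Filter (filter_from P above).
  apply: filter_from_filter; first by exists (fun=> 0).
  move=> p r Pp Pr; exists (fun x => p x + r x); first exact: PD.
  move=> t [Pt ler_t]; have [[_ p0] [_ r0]] := (Pc _ Pp, Pc _ Pr).
  by split; split=> // x; apply: le_trans (ler_t x); rewrite ?lerDl ?lerDr.
have [x _|p Pp sub] := cX _ (filter_from P above) (fun p x => 0 < p x) FF.
  have [p Pp px] := Pgt0 x; have [cp _] := Pc _ Pp.
  exists ([set y | 0 < p y], above p) => /=.
    by split; [exact: (cvgr_gt (p x) (cp x))|exists p].
  by move=> [y r] /= [py [_ /(_ y)]]; exact: lt_le_trans.
by exists p => // x; apply: (sub p).
Qed.

End Topology.

(** * Partial actions and their fixed points *)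

Section PartialActionTransport.
Context {G : groupType} {X : topologicalType} (theta : partial_action G X).
Local Notation dom := (pdom theta).
Local Notation act := (pact theta).

Lemma dom1 x : dom 1%g x.
Proof. by rewrite pdom1. Qed.

Lemma pact_dom_sub g x : dom g^-1%g x -> dom g (act g x).
Proof.
move=> xg; have : (act g @` (dom g^-1%g `&` dom 1%g)) (act g x).
  by exists x => //; split=> //; exact: dom1.
by rewrite pact_dom => -[].
Qed.

Lemma pactVK g x : dom g^-1%g x -> act g^-1%g (act g x) = x.
Proof.
by move=> xg; rewrite pactM ?mulVg ?pact1 ?invg1//; exact: dom1.
Qed.

Lemma pactKV g x : dom g x -> act g (act g^-1%g x) = x.
Proof. by move=> xg; have := @pactVK g^-1%g x; rewrite invgK; apply. Qed.

Lemma pactV_dom g x : dom g x -> dom g^-1%g (act g^-1%g x).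
Proof. by move=> xg; apply: pact_dom_sub; rewrite invgK. Qed.

(** The two inclusions are the axiom on [theta_g (X_(g^-1) `&` X_h)], read for
[g] and for [g^-1]. *)
Lemma pact_domE g h x : dom g^-1%g x -> dom h (act g x) <-> dom (g^-1 * h)%g x.
Proof.
move=> xg; split=> [xh|xh].
  have : (act g^-1%g @` (dom g^-1^-1%g `&` dom h)) x.
    exists (act g x); last exact: pactVK.
    by rewrite invgK; split=> //; exact: pact_dom_sub.
  by rewrite pact_dom => -[].
have : (act g @` (dom g^-1%g `&` dom (g^-1 * h)%g)) (act g x) by exists x.
by rewrite pact_dom mulVKg => -[].
Qed.

Lemma pactV_domE g h x : dom g x -> dom h (act g^-1%g x) <-> dom (g * h)%g x.
Proof.
by move=> xg; rewrite -[in (_ * _)%g](invgK g); apply: pact_domE; rewrite invgK.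
Qed.

Lemma invariant_act (C : set X) g x : invariant_set theta C ->
  dom g^-1%g x -> C (act g x) <-> C x.
Proof.
move=> invC xg; split=> Cx; last by apply: (invC g); exists x.
apply: (invC g^-1%g); exists (act g x); last exact: pactVK.
by split=> //; rewrite invgK; exact: pact_dom_sub.
Qed.

Lemma pact_within g : {within dom g^-1%g, continuous (act g)}.
Proof. by have [] := pact_homeo theta g. Qed.

Lemma pact_near g x (U : set X) : dom g^-1%g x -> nbhs (act g x) U ->
  nbhs x [set y | U (act g y)].
Proof.
move=> xg nU; have /subspace_continuousP/(_ x xg) := @pact_within g.
rewrite within_interior; first by apply.
by apply: open_nbhs_nbhs; split=> //; exact: pdom_open.
Qed.

Definition fixed_set g : set X := [set x | dom g^-1%g x /\ act g x = x].

Section Separation.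
Hypothesis X_clopen : forall h, clopen (dom h).
Hypothesis X_hausdorff : hausdorff_space X.

(** Where [theta_g] is undefined the clopen complement of its domain works;
where it moves [x], disjoint neighbourhoods of [x] and of its image do. *)
Lemma displace_nbhs g x : ~ fixed_set g x ->
  exists2 V, nbhs x V & forall y, V y -> dom g^-1%g y -> ~ V (act g y).
Proof.
move=> nfx; have [xg|nxg] := pselect (dom g^-1%g x); last first.
  exists (~` dom g^-1%g); last by move=> y nyg.
  apply: open_nbhs_nbhs; split=> //; apply: closed_openC.
  exact: (X_clopen _).2.
have gx : act g x != x by apply/eqP => gx; exact: nfx.
move: X_hausdorff; rewrite open_hausdorff.
move=> /(_ _ _ gx)[[U V] /= [Ux Vx] [oU oV UV]].
have nU := @pact_near g x U xg (open_nbhs_nbhs (conj oU (set_mem Ux))).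
have nV := open_nbhs_nbhs (conj oV (set_mem Vx)).
exists ([set y | U (act g y)] `&` V); first exact: filterI.
move=> y [Uy _] _ [_ Vy]; have : (U `&` V) (act g y) by [].
by rewrite (eqP UV).
Qed.

Lemma displace_nbhs_seq (s : seq G) x :
    (forall g, g \in s -> ~ fixed_set g x) ->
  exists2 V, nbhs x V &
    forall g y, g \in s -> V y -> dom g^-1%g y -> ~ V (act g y).
Proof.
elim: s => [_|g s IHs gs]; first by exists setT => //; exact: filterT.
have [V nV Vg] := displace_nbhs (gs g (mem_head _ _)).
have [|W nW Ws] := IHs; first by move=> h hs; apply: gs; rewrite inE hs orbT.
exists (V `&` W); first exact: filterI.
move=> h y; rewrite inE => /orP[/eqP->|hs] [Vy Wy] yh [Vhy Why].
  exact: (Vg y).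
exact: (Ws h y).
Qed.

Lemma fixed_set_closed g : closed (fixed_set g).
Proof.
rewrite -openC openE => x /= /displace_nbhs[V nV Vg].
by apply: filterS nV => y Vy [yg gy]; apply: (Vg y Vy yg); rewrite gy.
Qed.

End Separation.

(** If [theta_g] fixes [x] then
[theta_g (theta_h x) = theta_(gh) x = theta_(hg) x = theta_h x]. *)
Lemma fixed_set_invariant g : (forall h, commute g h) ->
  invariant_set theta (fixed_set g).
Proof.
move=> gC h _ [x [[xg gx] xh] <-].
have xgh : dom (g * h)^-1%g x.
  by rewrite (gC h) invgM; apply/(pact_domE _ xg); rewrite gx.
split; first by apply/(pact_domE _ xh); rewrite -invgM.
by rewrite pactM// (gC h) -pactM ?gx// -(gC h).
Qed.

End PartialActionTransport.

Section FixedPoints.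
Context {G : groupType} {X : topologicalType} {theta : partial_action G X}.
Hypothesis X_clopen : forall g : G, clopen (pdom theta g).
Hypothesis X_hausdorff : hausdorff_space X.
Local Notation dom := (pdom theta).

Lemma fixed_set_dichotomy g : (forall h, commute g h) ->
  topologically_minimal theta ->
  fixed_set theta g = set0 \/ fixed_set theta g = setT.
Proof.
move=> gC; apply; first exact: fixed_set_closed.
exact: fixed_set_invariant.
Qed.

(** Freeness can only fail at [g] when [theta_g] is the identity of [X], which a
faithful action excludes. *)
Lemma minimal_faithful_free : (forall g h : G, commute g h) ->
  topologically_minimal theta -> faithful_action theta ->
  topologically_free theta.
Proof.
move=> gC min faith g g1; have [gfix|gfix] := fixed_set_dichotomy (gC g) min.
  by apply/seteqP; split=> // x /interior_subset; rewrite -gfix.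
have [x xg] := faith g g1.
have : fixed_set theta g x by rewrite gfix.
by case.
Qed.

(** A map that is the identity on [X_(g^-1)] has this nonempty open set among
its fixed points; when [X_(g^-1)] is empty, freeness at [g] says nothing. *)
Lemma free_faithful : (forall g : G, dom g !=set0) ->
  topologically_free theta -> faithful_action theta.
Proof.
move=> dom0 free g g1; have [x xg] := dom0 g^-1%g.
apply: contrapT => nex; suff : set0 x by [].
rewrite -(free g g1); apply: (@filterS _ _ _ (dom g^-1%g)); last first.
  by apply: open_nbhs_nbhs; split=> //; exact: pdom_open.
by move=> y yg; split=> //; apply: contrapT => gy; apply: nex; exists y.
Qed.

End FixedPoints.

(** * The ring of continuous functions *)

Section FunctionAlgebra.
Context {R : realType} {X : topologicalType} {B : topologicalAlgType R}.
Context {E : set B} (E_lu : local_units (@amul R B) E).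
Implicit Types (e : B) (f : X -> B).

Lemma local_unit_idem e : E e -> e ** e = e.
Proof. exact: E_lu.1. Qed.

Lemma corner0 e : corner (@amul R B) e 0.
Proof. by exists 0; rewrite // amul0r amul0l. Qed.

Lemma cornerB e a b : E e -> corner (@amul R B) e a ->
  corner (@amul R B) e b -> corner (@amul R B) e (a - b).
Proof.
move=> /local_unit_idem ee /(cornerP _ ee)[ea ae] /(cornerP _ ee)[eb be].
by apply/(cornerP _ ee); rewrite amulBr amulBl ea ae eb be.
Qed.

Lemma cornerM e a b : E e -> corner (@amul R B) e a ->
  corner (@amul R B) e b -> corner (@amul R B) e (a ** b).
Proof.
move=> /local_unit_idem ee /(cornerP _ ee)[ea ae] /(cornerP _ ee)[eb be].
by apply/(cornerP _ ee); rewrite amulA ea -amulA be.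
Qed.

Lemma cornerZ e (r : R) : E e -> corner (@amul R B) e (r *: e).
Proof.
move=> /local_unit_idem ee; apply/(cornerP _ ee).
by rewrite amulZr amulZl ee.
Qed.

Lemma corner_trans e e' : E e -> E e' -> corner (@amul R B) e' e ->
  corner (@amul R B) e `<=` corner (@amul R B) e'.
Proof.
move=> /local_unit_idem ee /local_unit_idem ee' /(cornerP _ ee')[e'e eee'].
move=> b /(cornerP _ ee)[eb be]; apply/(cornerP _ ee').
by split; [rewrite -{1}eb amulA e'e eb|rewrite -{1}be -amulA eee' be].
Qed.

(** The finitely many units of the members of [F] themselves lie in one corner;
this makes [C_E] a ring. *)
Lemma C_E_common_unit (F : set (X -> B)) : finite_set F -> F `<=` C_E E ->
  exists2 e, E e & F `<=` C_corner e.
Proof.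
move=> finF FE.
have /choice[u u_] : forall f : X -> B, exists e,
    F f -> E e /\ C_corner (X:=X) e f.
  move=> f; have [Ff|] := pselect (F f); last by move=> nF; exists 0.
  by have [e Ee fe] := FE f Ff; exists e.
have [e Ee ue] := E_lu.2 _ (finite_image u finF).
exists e => // f Ff; have [Euf [cf fu]] := u_ f Ff.
by split=> // x; apply: (corner_trans Euf Ee); [apply: ue; exists f|exact: fu].
Qed.

Lemma C_EZ (p : X -> R) e : E e -> continuous p -> C_E E (fun x => p x *: e).
Proof.
move=> Ee cp; exists e => //; split=> [|x]; last exact: cornerZ.
by apply: continuous_scale => // x; exact: cvg_cst.
Qed.

Lemma C_E_cst e : E e -> C_E E (fun _ : X => e).
Proof.
move=> Ee; exists e => //; split=> [|x]; first by move=> x; exact: cvg_cst.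
by rewrite -[X in corner _ _ X](scale1r e); exact: cornerZ.
Qed.

Lemma C_E0 : C_E E (0 : X -> B).
Proof.
have [e Ee _] := E_lu.2 _ (finite_set0 B).
by exists e => //; split=> [|x]; [by move=> x; exact: cvg_cst|exact: corner0].
Qed.

Lemma C_E_common_unit2 f g : C_E E f -> C_E E g ->
  exists e, [/\ E e, C_corner (X:=X) e f & C_corner (X:=X) e g].
Proof.
move=> fE gE; have [|_ [->|->]//|e Ee fg] := @C_E_common_unit [set f; g].
  exact: finite_set2.
by exists e; split=> //; apply: fg; [left|right].
Qed.

Lemma C_EB f g : C_E E f -> C_E E g -> C_E E (f - g).
Proof.
move=> fE gE; have [e [Ee [cf fe] [cg ge]]] := C_E_common_unit2 fE gE.
exists e => //; split=> [|x]; first exact: continuous_sub.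
exact: cornerB.
Qed.

Lemma C_ED f g : C_E E f -> C_E E g -> C_E E (f + g).
Proof.
move=> fE gE; rewrite -[g]opprK -[- g]add0r.
by do 2?apply: C_EB => //; exact: C_E0.
Qed.

Lemma C_EM f g : C_E E f -> C_E E g -> C_E E (fmul f g).
Proof.
move=> fE gE; have [e [Ee [cf fe] [cg ge]]] := C_E_common_unit2 fE gE.
exists e => //; split=> [|x]; first exact: continuous_amul.
exact: cornerM.
Qed.

Context {G : groupType} (theta : partial_action G X).
Hypothesis X_clopen : forall g : G, clopen (pdom theta g).

(** Extension by zero stays continuous because [X_g] is clopen. *)
Lemma C_E_alpha g f : C_E E f -> C_E E (alpha theta g f).
Proof.
move=> [e Ee [cf fe]]; exists e => //; split=> [|x]; last first.
  by rewrite /alpha /patch; case: ifP => _; [exact: fe|exact: corner0].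
apply: continuous_patch0 => //.
have cg : {within pdom theta g, continuous (pact theta g^-1%g)}.
  by rewrite -[X in pdom _ X]invgK; exact: pact_within.
by move=> x; exact: (continuous_comp (cg x) (cf _)).
Qed.

End FunctionAlgebra.

(** * The partial skew group ring, pointwise *)

(** The element usually written [f delta_g]. *)
Definition single {G : groupType} {V : zmodType} (g : G) (f : V) : G -> V :=
  fun h => if h == g then f else 0.

Section SkewRing.
Context {G : groupType} {X : topologicalType} {theta : partial_action G X}.
Context {R : realType} {B : topologicalAlgType R} {E : set B}.
Hypothesis E_lu : local_units (@amul R B) E.
Hypothesis X_clopen : forall g : G, clopen (pdom theta g).

Local Notation dom := (pdom theta).
Local Notation act := (pact theta).
Local Notation S := (skew_ring (D_ideal theta E)).
Local Notation "a ⋆ b" := (skew_mul (@fmul R X B) (alpha theta) a b)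
  (at level 40, left associativity).
Implicit Types (a b : G -> X -> B) (f : X -> B) (g h k : G).

Lemma skew_coef0 a g x : S a -> ~ dom g x -> a g x = 0.
Proof. by move=> [/(_ g)[_]] ag _; exact: ag. Qed.

(** The point [theta_(g^-1) x] has no meaning for [x] outside [X_g], but there the
factor [a_g(x)] is zero; so no side condition appears in the sum. *)
Lemma skew_mulE a b k x : S a ->
  (a ⋆ b) k x = \sum_(g \in [set: G]) a g x ** b (g^-1 * k)%g (act g^-1%g x).
Proof.
move=> Sa; have [Da fa] := Sa.
rewrite /skew_mul fsbig_finite//= fct_sumE -fsbig_finite//.
rewrite -(@fsbig_widen _ _ _ _ [set g | a g != 0] setT)//; last first.
  by move=> g [_ /negP/negPn/eqP/= ag0]; rewrite ag0 amul0l.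
apply: eq_fsbigr => g _; have [xg|nxg] := pselect (dom g x); last first.
  by rewrite (skew_coef0 Sa nxg) amul0l /alpha patchC ?inE.
rewrite /alpha patchT ?inE//= /fmul patchT ?inE; last exact: pactV_dom.
by rewrite /= invgK pactKV.
Qed.

Lemma single_skew g f : D_ideal theta E g f -> S (single g f).
Proof.
move=> Df; split=> [h|].
  rewrite /single; case: eqP => [->//|_].
  by split=> //; exact: C_E0 E_lu.
apply: sub_finite_set (finite_set1 g) => h /=.
by rewrite /single; case: (h =P g) => // _; rewrite eqxx.
Qed.

Lemma fsum_at (F : G -> B) g : (forall h, h != g -> F h = 0) ->
  \sum_(h \in [set: G]) F h = F g.
Proof.
move=> F0; rewrite -(@fsbig_widen _ _ _ _ [set g] setT) ?fsbig_set1//.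
by move=> h [_ /eqP hg]; exact: F0.
Qed.

Lemma single_mulE g f b k x : D_ideal theta E g f ->
  (single g f ⋆ b) k x = f x ** b (g^-1 * k)%g (act g^-1%g x).
Proof.
move=> Df; rewrite skew_mulE; last exact: single_skew.
rewrite (@fsum_at _ g) => [|h /negPf hg]; first by rewrite /single eqxx.
by rewrite /single hg amul0l.
Qed.

Lemma mul_singleE a h f k x : S a ->
  (a ⋆ single h f) k x = a (k * h^-1)%g x ** f (act (k * h^-1)^-1%g x).
Proof.
move=> Sa; rewrite skew_mulE// (@fsum_at _ (k * h^-1)%g) => [|g].
  by rewrite /single invgM invgK mulgVK eqxx.
move=> gkh; rewrite /single; case: eqP => [gk|_]; last by rewrite amul0r.
by move: gkh; rewrite -gk invgM invgK mulVKg eqxx.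
Qed.

Lemma skew_sub a b : S a -> S b -> S (a - b).
Proof.
move=> [Da fa] [Db fb]; split=> [g|].
  have [ag a0] := Da g; have [bg b0] := Db g.
  split; first exact: (C_EB E_lu).
  by move=> x nx; rewrite [LHS](_ : _ = a g x - b g x)// a0// b0// subr0.
apply: (@sub_finite_set _ _ ([set g | a g != 0] `|` [set g | b g != 0])).
  move=> g /=; apply: contraPP.
  move=> /not_orP[/negP/negPn/eqP ag /negP/negPn/eqP bg].
  by rewrite /= [X in X != _](_ : _ = a g - b g)// ag bg subr0 eqxx.
by rewrite finite_setU.
Qed.

Lemma skew_mul_neq0 a b k x : S a -> (a ⋆ b) k x != 0 ->
  exists g, [/\ dom g x, a g x != 0 & b (g^-1 * k)%g (act g^-1%g x) != 0].
Proof.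
move=> Sa; rewrite skew_mulE//; apply: contra_neqP => nex.
apply: fsbig1 => g _; apply: contrapT => /eqP abg; apply: nex.
have ag : a g x != 0 by apply: contraNneq abg => ->; rewrite amul0l.
exists g; split=> //; last by apply: contraNneq abg => ->; rewrite amul0r.
by apply: contrapT => nxg; move: ag; rewrite (skew_coef0 Sa nxg) eqxx.
Qed.

(** If the coefficient at [k] is nonzero at [x], then for some [g] the point
[theta_(g^-1) x] lies in [X_(g^-1) `&` X_(g^-1 k)], which forces [x] into
[X_k]. *)
Lemma skew_mul_closed a b : S a -> S b -> S (a ⋆ b).
Proof.
move=> Sa Sb; have [Da fa] := Sa; have [Db fb] := Sb; split=> [k|].
  split.
    rewrite /skew_mul fsbig_finite//; apply: big_rec => [|g f _ fE].
      exact: C_E0 E_lu.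
    apply: (C_ED E_lu) => //; apply: C_E_alpha => //; apply: (C_EM E_lu).
      by apply: C_E_alpha => //; exact: (Da g).1.
    exact: (Db _).1.
  move=> x nxk; apply/eqP/negPn/negP => /(skew_mul_neq0 Sa)[g [xg _]].
  rewrite (skew_coef0 Sb) ?eqxx//.
  by move=> /(pactV_domE _ xg); rewrite mulVKg.
apply: (@sub_finite_set _ _ [set (p.1 * p.2)%g | p in
    [set g | a g != 0] `*` [set g | b g != 0]]); last first.
  by apply: finite_image; exact: finite_setX.
move=> k /eqP abk.
have [x /eqP abkx] : exists x, (a ⋆ b) k x <> 0.
  by apply/existsNP => ab0; apply: abk; apply/funext => x; exact: ab0.
have [g [_ agx bx]] := skew_mul_neq0 Sa abkx.
exists (g, (g^-1 * k)%g); last by rewrite /= mulVKg.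
split=> /=; [apply: contraNneq agx|apply: contraNneq bx] => -> //.
Qed.

Lemma fsumB (F H : G -> B) :
    finite_set [set g | F g != 0] -> finite_set [set g | H g != 0] ->
  \sum_(g \in [set: G]) (F g - H g) =
  \sum_(g \in [set: G]) F g - \sum_(g \in [set: G]) H g.
Proof.
move=> fF fH; pose P := [set g | F g != 0] `|` [set g | H g != 0].
have fP : finite_set P by rewrite finite_setU.
have PF (K : G -> B) : [set g | K g != 0] `<=` P ->
    \sum_(g \in [set: G]) K g = \sum_(g \in P) K g.
  move=> KP; rewrite -(@fsbig_widen _ _ _ _ P setT)//.
  by move=> g [_ nPg] /=; apply: contrapT => /eqP; move/KP.
rewrite (PF F) ?(PF H) ?PF; first by rewrite !fsbig_finite// sumrB.
- move=> g /=; apply: contraPP => /not_orP[/negP/negPn/eqP-> /negP/negPn/eqP->].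
  by rewrite subrr eqxx.
- exact: subsetUr.
- exact: subsetUl.
Qed.

Lemma skew_coef_finite a x : S a -> finite_set [set g | a g x != 0].
Proof.
move=> [_]; apply: sub_finite_set => g /=; by apply: contraNN => /eqP->.
Qed.

Lemma skew_term_finite a x (F : G -> B) : S a ->
  finite_set [set g | a g x ** F g != 0].
Proof.
move=> /(skew_coef_finite x); apply: sub_finite_set => g /=.
by apply: contraNN => /eqP->; rewrite amul0l.
Qed.

Lemma skew_mulBr a b c : S a -> a ⋆ (b - c) = a ⋆ b - a ⋆ c.
Proof.
move=> Sa; apply/funext => k; apply/funext => x.
rewrite [RHS](_ : _ = (a ⋆ b) k x - (a ⋆ c) k x)// !skew_mulE//.
rewrite -fsumB; [|exact: skew_term_finite..].
by apply: eq_fsbigr => g _; rewrite -amulBr.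
Qed.

Lemma skew_mulBl a b c : S a -> S b -> (a - b) ⋆ c = a ⋆ c - b ⋆ c.
Proof.
move=> Sa Sb; apply/funext => k; apply/funext => x.
rewrite [RHS](_ : _ = (a ⋆ c) k x - (b ⋆ c) k x)// !skew_mulE//; last first.
  exact: skew_sub.
rewrite -fsumB; [|exact: skew_term_finite..].
by apply: eq_fsbigr => g _; rewrite -amulBl.
Qed.

Lemma D_ideal1 f : C_E E f -> D_ideal theta E 1%g f.
Proof. by move=> fE; split=> // x; have := dom1 theta x. Qed.

Lemma skew0 : S 0.
Proof.
split=> [g|]; first by split=> //; exact: C_E0 E_lu.
by apply: sub_finite_set (finite_set0 G) => g /=; rewrite eqxx.
Qed.

Definition vanishing_ideal (C : set X) : set (G -> X -> B) :=
  [set a | S a /\ forall g x, C x -> a g x = 0].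

(** In the product formula [a_g] is evaluated at [x] and [b_h] at
[theta_(g^-1) x], which lies in [C] exactly when [x] does. *)
Lemma vanishing_ideal_ideal (C : set X) : invariant_set theta C ->
  is_ideal (skew_mul (@fmul R X B) (alpha theta)) S (vanishing_ideal C).
Proof.
move=> invC; split=> [a []//||a b [Sa a0] [Sb b0]|a b Sa [Sb b0]].
- by split=> //; exact: skew0.
- split=> [|g x Cx]; first exact: skew_sub.
  by rewrite [LHS](_ : _ = a g x - b g x)// a0// b0// subrr.
split; split=> [|k x Cx]; try exact: skew_mul_closed.
  apply/eqP/negPn/negP => /(skew_mul_neq0 Sa)[g [xg _]].
  rewrite b0 ?eqxx//; apply/(@invariant_act _ _ theta) => //.
  by rewrite invgK.
apply/eqP/negPn/negP => /(skew_mul_neq0 Sb)[g [xg]].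
by rewrite b0 ?eqxx.
Qed.

(** Left multiplication by the symbol [delta_g], in the case where [theta_g] is
the identity of [X]. *)
Definition translate g a : G -> X -> B := fun k => a (g^-1 * k)%g.

Section Translate.
Variable g : G.
Hypothesis gfix : fixed_set theta g = setT.

Let gx x : dom g^-1%g x /\ act g x = x.
Proof. by have : fixed_set theta g x by rewrite gfix. Qed.

Let gVx x : act g^-1%g x = x.
Proof. by have [xg xx] := gx x; rewrite -{1}xx pactVK. Qed.

Let domg x : dom g x.
Proof. by have [xg xx] := gx x; rewrite -xx; exact: pact_dom_sub. Qed.

Let dom_mul k x : dom (g * k)%g x <-> dom k x.
Proof. by rewrite -(pactV_domE _ (domg x)) gVx. Qed.

Let act_mulV k x : dom k x -> act (g * k)^-1%g x = act k^-1%g x.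
Proof.
move=> xk; rewrite invgM -pactM ?gVx//; first by rewrite invgK; exact: domg.
by rewrite invgM !invgK; apply/dom_mul.
Qed.

Lemma translate_skew a : S a -> S (translate g a).
Proof.
move=> [Da fa]; split=> [k|].
  have [ak ak0] := Da (g^-1 * k)%g; split=> // x nxk; apply: ak0.
  by move=> /dom_mul; rewrite mulVKg.
have := finite_image (fun k => (g * k)%g) fa; apply: sub_finite_set.
by move=> k /= ak; exists (g^-1 * k)%g => //; rewrite mulVKg.
Qed.

(** Reindexing the product formula by [h = g m] works because [X_(g m) = X_m]
and [theta_((g m)^-1) = theta_(m^-1)] when [theta_g] is the identity. *)
Lemma translate_mull a b : S a -> translate g a ⋆ b = translate g (a ⋆ b).
Proof.
move=> Sa; apply/funext => k; apply/funext => x.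
rewrite /translate !skew_mulE//; last exact: translate_skew.
rewrite (@reindex_fsbigT _ _ _ _ _ (fun m => (g * m)%g)); last first.
  by exists (fun m => (g^-1 * m)%g) => m; rewrite ?mulKg ?mulVKg.
apply: eq_fsbigr => m _; rewrite mulKg.
have [xm|nxm] := pselect (dom m x); last by rewrite (skew_coef0 Sa nxm) !amul0l.
by rewrite act_mulV// invgM mulgA.
Qed.

(** The shift reaches [b] past [h^-1], so [g] and [h] have to commute. *)
Lemma translate_mulr a b : (forall h, commute g h) -> S a ->
  a ⋆ translate g b = translate g (a ⋆ b).
Proof.
move=> gC Sa; apply/funext => k; apply/funext => x.
rewrite /translate !skew_mulE//; apply: eq_fsbigr => h _.
by rewrite !mulgA -(commuteV (commute_sym (gC _)))//.
Qed.

End Translate.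

End SkewRing.

(** * Simplicity, minimality and freeness *)

Section Simplicity.
Context {G : groupType} {X : topologicalType} {theta : partial_action G X}.
Context {R : realType} {B : topologicalAlgType R} {E : set B}.
Hypothesis X_nonempty : [set: X] !=set0.
Hypothesis X_compact : compact [set: X].
Hypothesis X_hausdorff : hausdorff_space X.
Hypothesis X_clopen : forall g : G, clopen (pdom theta g).
Hypothesis B_neq0 : exists b : B, b != 0.
Hypothesis E_lu : local_units (@amul R B) E.

Local Notation dom := (pdom theta).
Local Notation act := (pact theta).
Local Notation S := (skew_ring (D_ideal theta E)).
Local Notation "a ⋆ b" := (skew_mul (@fmul R X B) (alpha theta) a b)
  (at level 40, left associativity).
Local Notation skew_ideal :=
  (is_ideal (skew_mul (@fmul R X B) (alpha theta)) S).
Local Notation simple :=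
  (simple_skew_ring (@fmul R X B) (D_ideal theta E) (alpha theta)).
Implicit Types (a b : G -> X -> B) (f : X -> B) (g h k : G) (e : B).

Lemma single1_skew f : C_E E f -> S (single (1%g : G) f).
Proof. by move=> fE; apply: (single_skew E_lu); exact: D_ideal1. Qed.

Lemma unit_delta_skew e : E e -> S (single (1%g : G) (fun _ : X => e)).
Proof. by move=> Ee; apply: single1_skew; exact: (C_E_cst E_lu Ee). Qed.

Lemma unit_delta_neq0 e : e != 0 -> single (1%g : G) (fun _ : X => e) != 0.
Proof.
have [x _] := X_nonempty; apply: contra_neq => /(congr1 (fun a => a 1%g x)).
by rewrite /single eqxx.
Qed.

(** The ideal of [C] misses the constant units as soon as [C] is nonempty, and
contains a bump function times a unit as soon as [C] is not [X]. *)
Lemma simple_minimal : simple -> topologically_minimal theta.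
Proof.
move=> [_ simp] C cC invC; have [e Ee e0] := local_unit_neq0 E_lu B_neq0.
have [IE|IE] := simp _ (vanishing_ideal_ideal E_lu X_clopen invC); [right|left].
  apply/seteqP; split=> // x _; apply: contrapT => nCx.
  have nC : nbhs x (~` C).
    by apply: open_nbhs_nbhs; split=> //; exact: closed_openC.
  have [p [cp px pC]] := urysohn_bump R X_hausdorff X_compact nC.
  have : vanishing_ideal (theta:=theta) (E:=E) C
    (single (1%g : G) (fun x : X => p x *: e)).
    split=> [|g y Cy]; first by apply: single1_skew; exact: C_EZ.
    by rewrite /single; case: ifP => // _; rewrite pC ?scale0r.
  rewrite IE => /(congr1 (fun a => a 1%g x)).
  by rewrite /single eqxx px scale1r => /eqP; rewrite (negPf e0).
apply/seteqP; split=> // x Cx.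
have : vanishing_ideal (theta:=theta) (E:=E) C
    (single (1%g : G) (fun _ : X => e)).
  by rewrite IE; exact: unit_delta_skew.
by move=> [_ /(_ 1%g x Cx)]; rewrite /single eqxx => /eqP; rewrite (negPf e0).
Qed.

Definition coboundaries g : set (G -> X -> B) :=
  [set a - translate g a | a in S].

Lemma coboundaries_ideal g : (forall h, commute g h) ->
  fixed_set theta g = setT -> skew_ideal (coboundaries g).
Proof.
move=> gC gfix; have St a := @translate_skew _ _ _ _ _ E g gfix a.
have trB a b : translate g (a - b) = translate g a - translate g b by [].
split=> [_ [a Sa <-]||_ _ [a Sa <-] [b Sb <-]|a _ Sa [b Sb <-]].
- by apply: (skew_sub E_lu) => //; exact: St.
- exists 0; first exact: skew0.
  by rewrite -[X in translate _ X](subrr 0) trB !subrr.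
- exists (a - b); first exact: skew_sub.
  by rewrite trB opprD opprK opprB addrACA [- b + _]addrC.
split.
  exists (a ⋆ b); first exact: skew_mul_closed.
  by rewrite (skew_mulBr _ _ Sa) (translate_mulr _ gC Sa).
exists (b ⋆ a); first exact: skew_mul_closed.
by rewrite (skew_mulBl E_lu) ?(translate_mull gfix _ Sb)//; exact: St.
Qed.

(** Both terms have the same sum over [G], by reindexing. *)
Lemma coboundary_augmentation g a x : fixed_set theta g = setT -> S a ->
  \sum_(k \in [set: G]) (a - translate g a) k x = 0.
Proof.
move=> gfix Sa; have Sta := translate_skew gfix Sa.
rewrite fsumB; [|exact: skew_coef_finite Sa|exact: skew_coef_finite Sta].
rewrite (@reindex_fsbigT _ _ _ _ _ (fun m => (g^-1 * m)%g)) ?subrr//.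
by exists (fun m => (g * m)%g) => m; rewrite ?mulKg ?mulVKg.
Qed.

(** If [theta_g] is the identity, the coboundaries are an ideal that contains
[e delta_1 - e delta_g] but, by augmentation, not [e delta_1]. *)
Lemma simple_free : (forall g h : G, commute g h) -> simple ->
  topologically_free theta.
Proof.
move=> gC simp g g1.
have [gfix|gfix] := fixed_set_dichotomy X_clopen X_hausdorff (gC g)
  (simple_minimal simp).
  apply/seteqP; split=> // x /interior_subset.
  by rewrite -[[set _ | _]]/(fixed_set theta g) gfix.
exfalso; have [e Ee e0] := local_unit_neq0 E_lu B_neq0.
have [x _] := X_nonempty; pose u := single (1%g : G) (fun _ : X => e).
have Su : S u by exact: unit_delta_skew.
have [IE|IE] := simp.2 _ (coboundaries_ideal (gC g) gfix).
  have : coboundaries g (u - translate g u) by exists u.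
  rewrite IE => /(congr1 (fun a => a 1%g x)).
  rewrite [LHS](_ : _ = u 1%g x - u (g^-1 * 1)%g x)// mulg1 /u /single eqxx.
  case: eqP => [/(congr1 (fun h : G => h^-1%g))|_].
    by rewrite invgK invg1.
  by rewrite subr0 => /eqP; rewrite (negPf e0).
have : coboundaries g u by rewrite IE.
move=> [a Sa au]; have := coboundary_augmentation x gfix Sa.
rewrite au (@fsum_at _ _ _ _ 1%g) /u /single ?eqxx => [/eqP|h /negPf->//].
by rewrite (negPf e0).
Qed.

Definition unit_coef (J : set (G -> X -> B)) : set (X -> B) :=
  [set f | J (single 1%g f)].

Lemma single1_mul f a k x : C_E E f ->
  (single 1%g f ⋆ a) k x = f x ** a k x.
Proof.
move=> fE; rewrite (single_mulE E_lu); last exact: D_ideal1.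
by rewrite invg1 mul1g pact1.
Qed.

Lemma mul_single1 a f k x : S a ->
  (a ⋆ single 1%g f) k x = a k x ** f (act k^-1%g x).
Proof. by move=> Sa; rewrite (mul_singleE _ _ _ _ Sa) invg1 mulg1. Qed.

Lemma unit_coef_ideal J : skew_ideal J ->
  is_ideal (@fmul R X B) (C_E E) (unit_coef J).
Proof.
move=> [JS J0 JB JM].
have sB f1 f2 : single (1%g : G) (f1 - f2) = single 1%g f1 - single 1%g f2.
  apply/funext => k; rewrite [RHS](_ : _ = single 1%g f1 k - single 1%g f2 k)//.
  by rewrite /single; case: ifP; rewrite // subrr.
have IC f : unit_coef J f -> C_E E f.
  by move=> /JS[/(_ 1%g)[]]; rewrite /single eqxx.
have sM f1 f2 : C_E E f1 ->
    single (1%g : G) (fmul f1 f2) = single 1%g f1 ⋆ single 1%g f2.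
  move=> f1E; apply/funext => k; apply/funext => x.
  rewrite single1_mul// /single.
  by case: ifP => // _; rewrite amul0r.
split=> // [|f1 f2 J1 J2|f1 f2 f1E J2].
- rewrite /unit_coef /= (_ : single _ _ = 0)//; apply/funext => k.
  by rewrite /single; case: ifP.
- by rewrite /unit_coef /= sB; exact: JB.
by rewrite /unit_coef /= !sM//; [exact: JM (single1_skew f1E) J2|exact: IC].
Qed.

Lemma D_ideal_unit g e : E e ->
  D_ideal theta E g (patch (fun=> 0) (dom g) (fun=> e)).
Proof.
move=> Ee; split=> [|x nxg]; last by rewrite patchC ?inE.
exists e => //; split=> [|x].
  apply: continuous_patch0 => // x; exact: cvg_cst.
rewrite /patch; case: ifP => _; last exact: corner0.
by rewrite -[X in corner _ _ X](scale1r e); exact: (cornerZ E_lu).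
Qed.

Lemma common_unit_skew a : S a ->
  exists2 e, E e & forall g x, e ** a g x = a g x /\ a g x ** e = a g x.
Proof.
move=> [Da fa]; have [|e Ee ae] := C_E_common_unit E_lu (finite_image a fa).
  by move=> _ [g _ <-]; exact: (Da g).1.
exists e => // g x; have [->|ag] := eqVneq (a g) 0.
  by rewrite amul0l amul0r.
have [|_ /(_ x)] := ae (a g); first by exists g.
by move=> /(cornerP _ (local_unit_idem E_lu Ee)).
Qed.

(** Property (P) for the zero ideal gives [q 0 = 0], so that [q] detects zero and
open conditions on [q] express that a function does not vanish. *)
Lemma property_P_sharp : property_P X E -> exists q : B -> R,
  [/\ continuous q, forall z, 0 <= q z, forall z, 0 < q z <-> z != 0 &
    forall I : set (X -> B), is_ideal (@fmul R X B) (C_E E) I ->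
    forall e f, E e -> I f -> C_corner e f -> I (fun x => q (f x) *: e)].
Proof.
move=> [q [cq q_ge0 q_gt0 qI]]; exists q; split=> // z.
split=> [|/q_gt0//]; apply: contraTneq => ->; rewrite -leNgt.
have [e Ee e0] := local_unit_neq0 E_lu B_neq0; have [x _] := X_nonempty.
have I0 : is_ideal (@fmul R X B) (C_E E) [set 0].
  split=> [_ ->|//|_ _ -> ->|f _ fE ->]; [exact: C_E0 E_lu|exact: subrr|].
  by split; apply/funext => y; [exact: amul0r|exact: amul0l].
have c0 : C_corner (X:=X) e 0.
  by split=> [y|y]; [exact: cvg_cst|exact: corner0].
have /(congr1 (@^~ x))/eqP := qI _ I0 e 0 Ee erefl c0.
by rewrite scaler_eq0 (negPf e0) orbF => /eqP->.
Qed.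

Section Ideal.
Variable J : set (G -> X -> B).
Hypothesis J_ideal : skew_ideal J.

Let JS a : J a -> S a.
Proof. by have [JS _ _ _] := J_ideal; exact: JS. Qed.

Let JMl a b : S a -> J b -> J (a ⋆ b).
Proof. by move=> Sa Jb; have [_ _ _ /(_ a b Sa Jb)[]] := J_ideal. Qed.

Let JMr a b : J a -> S b -> J (a ⋆ b).
Proof. by move=> Ja Sb; have [_ _ _ /(_ b a Sb Ja)[]] := J_ideal. Qed.

(** Multiplying by [e delta_(g^-1)] on the right moves the coefficient at [g] to
the identity. *)
Lemma ideal_diag_coef a : J a -> a != 0 -> exists b x, J b /\ b 1%g x != 0.
Proof.
move=> Ja a0; have Sa := JS Ja.
have [g [x agx]] : exists g x, a g x != 0.
  apply: contrapT => nex; move/eqP: a0; apply.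
  apply/funext => g; apply/funext => x.
  by apply: contrapT => /eqP agx; apply: nex; exists g, x.
have [e Ee ae] := common_unit_skew Sa.
have xg : dom g x.
  by apply: contrapT => nxg; move: agx; rewrite (skew_coef0 Sa nxg) eqxx.
exists (a ⋆ single g^-1%g (patch (fun=> 0) (dom g^-1%g) (fun=> e))), x; split.
  by apply: JMr => //; apply: (single_skew E_lu); exact: D_ideal_unit.
rewrite (mul_singleE _ _ _ _ Sa) invgK mul1g patchT ?inE; last first.
  exact: pactV_dom.
by rewrite (ae g x).2.
Qed.

(** The product [(e delta_(g^-1)) (p e delta_1) (e delta_g)] is supported at the
identity, with coefficient [(p \o theta_g) e] on [X_(g^-1)] and zero elsewhere. *)
Lemma ideal_transport (p : X -> R) e g : continuous p -> E e ->
  unit_coef J (fun x => p x *: e) ->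
  unit_coef J (fun x => patch (fun=> 0) (dom g^-1%g) (p \o act g) x *: e).
Proof.
move=> cp Ee Jp; have ee := local_unit_idem E_lu Ee.
pose u h := patch (fun=> 0) (dom h) (fun=> e) : X -> B.
have Su h : S (single h (u h)).
  by apply: (single_skew E_lu); exact: D_ideal_unit.
have := JMr (JMl (Su g^-1%g) Jp) (Su g).
rewrite /unit_coef /=; congr J; apply/funext => k; apply/funext => x.
rewrite (mul_singleE _ _ _ _ (JS (JMl (Su _) Jp))).
rewrite (single_mulE E_lu); last exact: D_ideal_unit.
rewrite invgK /single.
have -> : (g * (k * g^-1) == 1)%g = (k == 1%g).
  apply/eqP/eqP => [/(congr1 (fun h => g^-1 * h * g)%g)|->].
    by rewrite mulKg mulgVK mulg1 mulVg.
  by rewrite mul1g mulgV.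
case: eqP => [->|_]; last by rewrite amul0r amul0l.
rewrite mul1g invgK /u.
have [xg|nxg] := pselect (dom g^-1%g x).
  rewrite !patchT ?inE//; last exact: pact_dom_sub.
  by rewrite amulZr amulZl ee ee.
have nx : x \in ~` dom g^-1%g by rewrite inE.
by rewrite !(patchC _ _ nx) !amul0l scale0r.
Qed.

Hypothesis theta_minimal : topologically_minimal theta.
Hypothesis theta_free : topologically_free theta.
Hypothesis B_P : property_P X E.

(** Freeness gives a point [x] with [a_1 x <> 0] that is moved by every other [g]
in the support.  Compressing [a] by a bump function near [x] kills all the
coefficients but the one at 1. *)
Lemma ideal_meets_base : J !=set0 -> J <> [set 0] ->
  exists f x, unit_coef J f /\ f x != 0.
Proof.
move=> J_ne J_nz; have [a Ja a0] : exists2 a, J a & a != 0.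
  apply: contrapT => nex; apply: J_nz; apply/seteqP; split=> [a Ja|_ ->].
    by apply: contrapT => /eqP a0; apply: nex; exists a.
  by have [] := J_ideal.
have [{a0}b [x0 [Jb bx0]]] := ideal_diag_coef Ja a0; have Sb := JS Jb.
have [q [cq q_ge0 q_gt0 _]] := property_P_sharp B_P.
have [e Ee be] := common_unit_skew Sb.
have cb1 : continuous (b 1%g) by have [/(_ 1%g)[[e' _ [cb _]] _] _] := Sb.
pose U := [set x | 0 < q (b 1%g x)].
have oU : open U.
  rewrite openE => x Ux /=.
  have cqb : {for x, continuous (q \o b 1%g)}.
    by apply: continuous_comp; [exact: cb1|exact: cq].
  exact: (cvgr_gt _ cqb).
(* The support is inverted so that [theta_(k^-1)], which occurs in the
   coefficient at k, becomes [theta_g] for g in s. *)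
have [s sE] : exists s : seq G, forall g, g \in s <-> g != 1%g /\ b g^-1%g != 0.
  have fin : finite_set [set g | g != 1%g /\ b g^-1%g != 0].
    have := finite_image (fun g => g^-1%g) Sb.2; apply: sub_finite_set.
    by move=> g [_ bg]; exists g^-1%g; rewrite ?invgK.
  have [s sE] := (@finite_seqP _ _).1 fin.
  exists s => g.
  by rewrite -[_ /\ _]/([set h | h != 1%g /\ b h^-1%g != 0] g) sE.
have [x Ux xs] : exists2 x, U x & forall g, g \in s -> ~ fixed_set theta g x.
  apply: avoid_nowhere_dense => //; last by exists x0; apply/q_gt0.
  move=> g /sE[/eqP g1 _]; split; first exact: fixed_set_closed.
  exact: theta_free.
have [V nV Vs] := displace_nbhs_seq X_clopen X_hausdorff xs.
have [p [cp px pV]] := urysohn_bump R X_hausdorff X_compact nV.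
pose u : X -> B := fun y => p y *: e.
have uE : C_E E u by exact: C_EZ.
pose c := (single 1%g u ⋆ b) ⋆ single 1%g u.
have cE k y : c k y = u y ** b k y ** u (act k^-1%g y).
  rewrite /c mul_single1 ?single1_mul//; apply: JS; apply: JMl => //.
  exact: single1_skew.
have c_off k : k != 1%g -> c k = 0.
  move=> k1; apply/funext => y; rewrite cE.
  have [->|bk] := eqVneq (b k) 0; first by rewrite amul0r amul0l.
  have [yk|nyk] := pselect (dom k y); last first.
    by rewrite (skew_coef0 Sb nyk) amul0r amul0l.
  have [Vy|nVy] := pselect (V y); last by rewrite /u pV// scale0r !amul0l.
  rewrite [X in _ ** X](_ : _ = 0) ?amul0r// /u pV ?scale0r//.
  apply: (Vs k^-1%g) => //; last by rewrite invgK.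
  apply/sE; rewrite invgK; split=> //; apply: contra_neq k1.
  by move=> /(congr1 (fun h : G => h^-1%g)); rewrite invgK invg1.
exists (c 1%g), x; split.
  have -> : unit_coef J (c 1%g) = J c; last first.
    by apply: JMr; [apply: JMl|] => //; exact: single1_skew.
  congr J; apply/funext => k; rewrite /single.
  by case: (k =P 1%g) => [->|/eqP/c_off->].
rewrite cE invg1 pact1 /u px scale1r (be _ _).1 (be _ _).2.
exact/q_gt0.
Qed.

(** Working with the scalar functions [p] such that [p e delta_1] is in [J], and
not with [unit_coef J] itself, makes the common zero set closed whether or not
points of [B] are closed, and lets positive functions be inverted. *)
Lemma ideal_contains_units e : J !=set0 -> J <> [set 0] -> E e ->
  unit_coef J (fun=> e).
Proof.
move=> J_ne J_nz Ee; have Iid := unit_coef_ideal J_ideal.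
have [IE I0 IB IM] := Iid.
have [q [cq q_ge0 q_gt0 qI]] := property_P_sharp B_P.
have ee := local_unit_idem E_lu Ee.
pose P := [set p : X -> R | [/\ continuous p, forall x, 0 <= p x &
  unit_coef J (fun x => p x *: e)]].
have ID f1 f2 : unit_coef J f1 -> unit_coef J f2 -> unit_coef J (f1 + f2).
  move=> If1 If2; rewrite -[f2]opprK -[- f2]add0r.
  exact: (IB _ _ If1 (IB _ _ I0 If2)).
have PD p r : P p -> P r -> P (fun x => p x + r x).
  move=> [cp p0 Ip] [cr r0 Ir]; split=> [x|x|].
  - by apply: cvgD; [exact: cp|exact: cr].
  - exact: addr_ge0.
  have := ID _ _ Ip Ir; congr (unit_coef J _); apply/funext => x.
  by rewrite scalerDl.
have P0 : P (fun=> 0).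
  split=> // [x|]; first exact: cvg_cst.
  by move: I0; congr (unit_coef J _); apply/funext => x; rewrite scale0r.
pose C := [set x | forall p, P p -> p x = 0].
have [C0|CT] : C = set0 \/ C = setT.
- apply: theta_minimal.
    rewrite (_ : C = \bigcap_(p in P) (p @^-1` [set 0])); last first.
      by apply/seteqP; split=> x Cx p Pp; exact: Cx.
    apply: closed_bigI => p [/continuous_closedP pcl _ _].
    apply: pcl; exact: closed_eq.
  move=> g _ [x [Cx xg] <-] p [cp p0 Ip].
  have := Cx (patch (fun=> 0) (dom g^-1%g) (p \o act g)).
  rewrite patchT ?inE//; apply; split; last exact: ideal_transport.
    apply: continuous_patch0 => // y.
    exact: (continuous_comp (@pact_within _ _ theta g y) (cp _)).
  by move=> y; rewrite /patch; case: ifP => // _; exact: p0.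
- have [p [cp p0 Ip] pgt0] : exists2 p, P p & forall x, 0 < p x.
    apply: common_positive => // [p []//|x].
    apply: contrapT => nex; suff : C x by rewrite C0.
    move=> p Pp; have [_ p0 _] := Pp; apply/eqP; rewrite eq_le p0 andbT leNgt.
    by apply/negP => px; apply: nex; exists p.
  have cV : C_E E (fun x => (p x)^-1 *: e).
    apply: C_EZ => // x; apply: cvgV; last exact: cp.
    by rewrite gt_eqF.
  have [+ _] := IM _ _ cV Ip; congr (unit_coef J _); apply/funext => x.
  by rewrite /fmul amulZl amulZr ee scalerA mulVf ?scale1r// gt_eqF.
(* If every such p vanished identically, so would [q \o f] for f in I. *)
exfalso; have [f [x [If fx]]] := ideal_meets_base J_ne J_nz.
have [e' [Ee' fe' ee']] := C_E_common_unit2 E_lu (IE _ If)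
  (C_E_cst (X:=X) E_lu Ee).
have [_ /(_ x)/(cornerP _ (local_unit_idem E_lu Ee'))[e'e _]] := ee'.
have [_ +] := IM _ _ (C_E_cst (X:=X) E_lu Ee) (qI _ Iid e' f Ee' If fe').
have -> : fmul (fun x0 : X => q (f x0) *: e') (fun=> e) = fun x => q (f x) *: e.
  by apply/funext => y; rewrite /fmul amulZl e'e.
move=> Iq; have : P (q \o f).
  split=> [y|y|//]; last exact: q_ge0.
  by have [cf _] := fe'; apply: continuous_comp; [exact: cf|exact: cq].
have : C x by rewrite CT.
by move=> Cx /Cx/= qfx; have := (q_gt0 (f x)).2 fx; rewrite qfx ltxx.
Qed.

Lemma ideal_full : J !=set0 -> J <> [set 0] -> J = S.
Proof.
move=> J_ne J_nz; apply/seteqP; split=> // a Sa.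
have [e Ee ae] := common_unit_skew Sa.
have := JMr (ideal_contains_units J_ne J_nz Ee) Sa; congr J.
apply/funext => k; apply/funext => x.
rewrite single1_mul; last exact: (C_E_cst E_lu Ee).
exact: (ae k x).1.
Qed.

End Ideal.

Lemma minimal_free_simple : property_P X E ->
  topologically_minimal theta -> topologically_free theta -> simple.
Proof.
move=> B_P min free; split=> [|J J_ideal].
  have [e Ee e0] := local_unit_neq0 E_lu B_neq0.
  exists (single 1%g (fun _ : X => e)); first exact: unit_delta_skew.
  exact: unit_delta_neq0.
have [->|J_nz] := pselect (J = [set 0]); [by left|right].
by apply: ideal_full => //; exists 0; have [] := J_ideal.
Qed.

End Simplicity.

Theorem theorem1p4 (G : groupType) (X : topologicalType)
    (theta : partial_action G X) (R : realType) (B : topologicalAlgType R)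
    (E : set B)
    (G_abelian : forall g h : G, commute g h)
    (X_nonempty : [set: X] !=set0)
    (X_compact : compact [set: X])
    (X_hausdorff : hausdorff_space X)
    (X_clopen : forall g : G, clopen (pdom theta g))
    (B_simple : is_simple (@amul R B) [set: B])
    (E_local_units : local_units (@amul R B) E)
    (B_P : property_P X E) :
  let simple_C_E_skew_G :=
    simple_skew_ring (@fmul R X B) (D_ideal theta E) (alpha theta) in
  [/\ simple_C_E_skew_G <->
        topologically_minimal theta /\ topologically_free theta,
      topologically_minimal theta /\ faithful_action theta ->
        topologically_minimal theta /\ topologically_free theta &
      (forall g : G, pdom theta g !=set0) ->
        topologically_minimal theta /\ topologically_free theta ->
        topologically_minimal theta /\ faithful_action theta].
Proof.
move=> simple; have B_neq0 : exists b : B, b != 0.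
  by have [[b _ b0] _] := B_simple; exists b.
split=> [|[min faith]|dom0 [min free]].
- split=> [simp|[min free]]; last exact: minimal_free_simple.
  by split; [exact: simple_minimal simp|exact: simple_free simp].
- by split=> //; exact: minimal_faithful_free.
by split=> //; exact: free_faithful.
Qed.
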